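(* Let $G$ be a finite two-generated nilpotent group with direct product decomposition $G\cong\prod_{i=1}^k G_i$, where $G_i$ is the Sylow $p_i$-subgroup of $G$ ($p_1,\dots,p_k$ the distinct primes dividing $|G|$), and let $\pi_i:G\to G_i$ be the natural projections. Then every regular dessin $\mathcal{D}=(G,x,y)$ is (isomorphic to) the parallel product of the regular dessins $\mathcal{D}_i=(G_i,x_i,y_i)$, $i=1,\dots,k$, where $x_i=\pi_i(x)$ and $y_i=\pi_i(y)$. Moreover, for any $\sigma\in\mathrm{Aut}(\Delta)$, $\mathcal{D}$ possesses the external symmetry $\sigma$ if and only if each $\mathcal{D}_i$ $(i=1,\dots,k)$ possesses the external symmetry $\sigma$.
   Context: A regular dessin is a triple $(G,x,y)$ with $G$ a finite group generated by $x,y$; two are isomorphic if $x_1\mapsto x_2$, $y_1\mapsto y_2$ extends to a group isomorphism. The parallel product of dessins $(G_j,x_j,y_j)$, $j=1,\dots,k$, is $(H,x,y)$ with $x=(x_1,\dots,x_k)$, $y=(y_1,\dots,y_k)$ and $H=\langle x,y\rangle\le\prod_j G_j$ (iterating the binary parallel product). Let $\Delta=\langle X,Y\mid -\rangle$ be the free group of rank 2. For $\sigma\in\mathrm{Aut}(\Delta)$ with $\sigma(X)=u(X,Y)$, $\sigma(Y)=v(X,Y)$, a dessin $(G,x,y)$ possesses the external symmetry $\sigma$ if the assignment $x\mapsto u(x,y)$, $y\mapsto v(x,y)$ extends to an automorphism of $G$. *)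

(* Defs.v *)
From HB Require Import structures.
From mathcomp Require Import all_boot all_fingroup all_solvable.

Set Implicit Arguments.
Unset Strict Implicit.
Unset Printing Implicit Defensive.

Import GroupScope.

(* The free group Delta = < X, Y | - >, realised as the reduced words in the   *)
(* letters X, Y, X^-1, Y^-1. A letter is a pair (generator, inverted?), where  *)
(* the generator false stands for X and true for Y.                            *)

Definition letter : Type := (bool * bool)%type.

Definition linv (l : letter) : letter := (l.1, ~~ l.2).

Definition reduced (w : seq letter) : bool :=
  sorted (fun l m : letter => m != linv l) w.

Definition push (l : letter) (w : seq letter) : seq letter :=
  if w is m :: w' then if m == linv l then w' else l :: w else [:: l].

Definition reduce (w : seq letter) : seq letter := foldr push [::] w.

Lemma linvK : involutive linv.
Proof. by case=> a b; rewrite /linv /= negbK. Qed.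

Lemma reduced_push l w : reduced w -> reduced (push l w).
Proof.
case: w => //= m w pw; case: ifP => [_|/negbT ml] /=; last by rewrite ml.
exact: path_sorted pw.
Qed.

Lemma reduced_foldr_push u w : reduced w -> reduced (foldr push w u).
Proof. by move=> rw; elim: u => //= l u; exact: reduced_push. Qed.

Lemma reduced_reduce w : reduced (reduce w).
Proof. exact: reduced_foldr_push. Qed.

Lemma reduce_id w : reduced w -> reduce w = w.
Proof.
elim: w => //= l w IHw pw; rewrite (IHw (path_sorted pw)).
by case: w pw {IHw} => //= m w /andP[/negPf-> _].
Qed.

Lemma pushK l w : reduced w -> push l (push (linv l) w) = w.
Proof.
case: w => [|m w] /=; first by rewrite eqxx.
rewrite linvK; case: (altP (m =P l)) => [->|_ _] /=; last by rewrite eqxx.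
by case: w => [|n w] //= /andP[/negPf-> _].
Qed.

Lemma foldr_push_push l u w : reduced w ->
  foldr push w (push l u) = push l (foldr push w u).
Proof.
move=> rw; case: u => [|m u] //=; case: ifP => //= /eqP->.
by rewrite pushK // reduced_foldr_push.
Qed.

Lemma foldr_push_reduce u w : reduced w ->
  foldr push w (reduce u) = foldr push w u.
Proof. by move=> rw; elim: u => //= l u IHu; rewrite foldr_push_push // IHu. Qed.

Lemma reduce_cat u v : reduce (u ++ v) = foldr push (reduce v) u.
Proof. by rewrite /reduce foldr_cat. Qed.

Lemma reduce_catl u v : reduce (reduce u ++ v) = reduce (u ++ v).
Proof. by rewrite !reduce_cat foldr_push_reduce ?reduced_reduce. Qed.

Lemma reduce_catr u v : reduce (u ++ reduce v) = reduce (u ++ v).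
Proof. by rewrite !reduce_cat (reduce_id (reduced_reduce v)). Qed.

Definition winv (w : seq letter) : seq letter := rev (map linv w).

Lemma winvK : involutive winv.
Proof. by move=> w; rewrite /winv map_rev revK (mapK linvK). Qed.

Lemma reduced_winv w : reduced w -> reduced (winv w).
Proof.
rewrite /reduced /winv rev_sorted sorted_map.
apply: sub_sorted => l m /=; apply: contraNN => /eqP; rewrite linvK => ->.
by rewrite eqxx.
Qed.

Lemma reduce_catV w : reduce (w ++ winv w) = [::].
Proof.
elim: w => //= l w IHw; rewrite /winv /= rev_cons -cats1 catA -/(winv w).
by rewrite -reduce_catl IHw /= eqxx.
Qed.

Lemma reduce_Vcat w : reduce (winv w ++ w) = [::].
Proof. by rewrite -{2}[w]winvK reduce_catV. Qed.

Record Delta : Type := MkDelta { dword :> seq letter; _ : reduced dword }.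

HB.instance Definition _ := [isSub for dword].
HB.instance Definition _ := [Choice of Delta by <:].

Lemma reduced_dword (u : Delta) : reduced u.
Proof. by case: u. Qed.

Definition Delta_one : Delta := @MkDelta [::] isT.
Definition Delta_mul (u v : Delta) : Delta := MkDelta (reduced_reduce (u ++ v)).
Definition Delta_inv (u : Delta) : Delta :=
  MkDelta (reduced_winv (reduced_dword u)).

Lemma Delta_mulA : associative Delta_mul.
Proof.
by move=> u v w; apply: val_inj; rewrite /= reduce_catl reduce_catr catA.
Qed.

Lemma Delta_mul1 : left_id Delta_one Delta_mul.
Proof. by move=> u; apply: val_inj; exact/reduce_id/reduced_dword. Qed.

Lemma Delta_mulr1 : right_id Delta_one Delta_mul.
Proof.
by move=> u; apply: val_inj; rewrite /= cats0; exact/reduce_id/reduced_dword.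
Qed.

Lemma Delta_mulV : left_inverse Delta_one Delta_inv Delta_mul.
Proof. by move=> u; apply: val_inj; exact: reduce_Vcat. Qed.

Lemma Delta_mulrV : right_inverse Delta_one Delta_inv Delta_mul.
Proof. by move=> u; apply: val_inj; exact: reduce_catV. Qed.

HB.instance Definition _ := isGroup.Build Delta
  Delta_mulA Delta_mul1 Delta_mulr1 Delta_mulV Delta_mulrV.

Definition DX : Delta := @MkDelta [:: (false, false)] isT.
Definition DY : Delta := @MkDelta [:: (true, false)] isT.

(* For u = u(X, Y) in Delta, [ev x y u] is the value u(x, y).                  *)

Definition lev (gT : groupType) (x y : gT) (l : letter) : gT :=
  let g := if l.1 then y else x in if l.2 then g^-1 else g.

Definition ev (gT : groupType) (x y : gT) (u : Delta) : gT :=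
  \prod_(l <- dword u) lev x y l.

(* (Delta, DX, DY) has the universal property of the free group: [ev x y] is   *)
(* the unique group morphism sending DX to x and DY to y.                      *)

Lemma evX (gT : groupType) (x y : gT) : ev x y DX = x.
Proof. by rewrite /ev big_seq1. Qed.

Lemma evY (gT : groupType) (x y : gT) : ev x y DY = y.
Proof. by rewrite /ev big_seq1. Qed.

Lemma lev_linv (gT : groupType) (x y : gT) l : lev x y (linv l) = (lev x y l)^-1.
Proof. by case: l => -[] []; rewrite /lev //= invgK. Qed.

Lemma lev_reduce (gT : groupType) (x y : gT) w :
  \prod_(l <- reduce w) lev x y l = \prod_(l <- w) lev x y l.
Proof.
elim: w => //= l w IHw; rewrite big_cons -IHw.
case: (reduce w) => [|m v] /=; first by rewrite big_seq1 big_nil mulg1.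
case: ifP => [/eqP->|_]; last by rewrite big_cons.
by rewrite big_cons lev_linv mulKVg.
Qed.

Lemma evM (gT : groupType) (x y : gT) : {morph ev x y : u v / u * v}.
Proof. by move=> u v; rewrite /ev /= lev_reduce big_cat. Qed.

Lemma ev_unique (gT : groupType) (x y : gT) (f : Delta -> gT) :
  {morph f : u v / u * v} -> f DX = x -> f DY = y -> f =1 ev x y.
Proof.
move=> fM fX fY.
have f1 : f 1 = 1 by apply: (mulgI (f 1)); rewrite -fM !mulg1.
have fV u : f u^-1 = (f u)^-1.
  by apply: (mulgI (f u)); rewrite -fM !mulgV.
have fl l (rl : reduced [:: l]) : f (MkDelta rl) = lev x y l.
  case: l rl => -[] [] rl; rewrite /lev /=.
  - by rewrite -fY -fV; congr f; apply: val_inj.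
  - by rewrite -fY; congr f; apply: val_inj.
  - by rewrite -fX -fV; congr f; apply: val_inj.
  - by rewrite -fX; congr f; apply: val_inj.
case=> w; elim: w => [|l w IHw] rw.
  by rewrite /ev big_nil -f1; congr f; apply: val_inj.
have rw' : reduced w := path_sorted rw.
have rl : reduced [:: l] by [].
have -> : MkDelta rw = MkDelta rl * MkDelta rw'.
  by apply: val_inj; rewrite /= -[push l _]/(reduce (l :: w)) reduce_id.
by rewrite fM evM fl IHw /ev big_seq1.
Qed.

(* A candidate dessin (G, x, y); it is a regular dessin when x, y generate G.  *)

Record dessin : Type := Dessin {
  dtype : finGroupType;
  dgroup : {group dtype};
  dx : dtype;
  dy : dtype
}.

Definition is_regular_dessin (D : dessin) : Prop :=
  dgroup D = <<[set dx D; dy D]>>%G.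

Definition dessin_isomorphic (D1 D2 : dessin) : Prop :=
  exists f : {morphism dgroup D1 >-> dtype D2},
    [/\ isom (dgroup D1) (dgroup D2) f, f (dx D1) = dx D2 & f (dy D1) = dy D2].

Definition parallel_product (I : finType) (D : I -> dessin) : dessin :=
  let x : {dffun forall i, dtype (D i)} := [ffun i => dx (D i)] in
  let y : {dffun forall i, dtype (D i)} := [ffun i => dy (D i)] in
  @Dessin {dffun forall i, dtype (D i)} <<[set x; y]>>%G x y.

(* [Aut G] consists of the permutations of the ambient type that fix the       *)
(* complement of G and restrict to automorphisms of G.                         *)

Definition external_symmetry (D : dessin) (sigma : Delta -> Delta) : Prop :=
  exists2 a : {perm dtype D}, a \in Aut (dgroup D) &
    a (dx D) = ev (dx D) (dy D) (sigma DX) /\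
    a (dy D) = ev (dx D) (dy D) (sigma DY).

(* Natural projection onto the i-th factor of an internal direct product of    *)
(* the groups Gs: g is decomposed as \prod_j z j with z j in Gs j, and sent to *)
(* z i. The default value 1 is only used when there is no such decomposition.  *)

Definition dprod_proj (gT : finGroupType) (k : nat) (Gs : 'I_k -> {group gT})
    (i : 'I_k) (g : gT) : gT :=
  if [pick z : {ffun 'I_k -> gT} |
        [forall j, z j \in Gs j] && (\prod_j z j == g)] is Some z
  then z i else 1.

Lemma dprod_projP (gT : finGroupType) (k : nat) (Gs : 'I_k -> {group gT})
    (G : {group gT}) (z : 'I_k -> gT) (i : 'I_k) :
  \big[dprod/1]_j Gs j = G -> (forall j, z j \in Gs j) ->
  dprod_proj Gs i (\prod_j z j) = z i.
Proof.
move=> dG zG; rewrite /dprod_proj; case: pickP => [t|/(_ (finfun z))]; last first.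
  have -> : [forall j, finfun z j \in Gs j].
    by apply/forallP => j; rewrite ffunE.
  by under eq_bigr do rewrite ffunE; rewrite eqxx.
case/andP=> /forallP tG /eqP e.
have gG : \prod_j z j \in G by rewrite -(bigdprodW dG) mem_prodg.
have [c [_ _ uc]] := mem_bigdprod dG gG.
by rewrite (uc t (fun j _ => tG j) (esym e) i) // (uc z (fun j _ => zG j)).
Qed.

(* Main.v *)
Require Import Defs.
From HB Require Import structures.
From mathcomp Require Import all_boot all_fingroup all_solvable.

Set Implicit Arguments.
Unset Strict Implicit.
Unset Printing Implicit Defensive.

Import GroupScope.

(** A finite nilpotent group is the internal direct product of its Sylow
    subgroups, so the [pi_i] are morphisms that jointly separate the points of
    [G]; hence [g |-> (pi_i g)_i] is an isomorphism from [D] onto the parallel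
    product of the [D_i]. External symmetries pass to the image of a dessin by a
    morphism with characteristic kernel, and [pi_i] is such a morphism because
    the Sylow subgroups are characteristic. Conversely, whatever the dessins
    [D_i], automorphisms [a_i] realising [sigma] act coordinatewise on the
    product of the [G_i], and this action stabilises the subgroup generated by
    [(x_i)_i] and [(y_i)_i], because it sends these generators to their values
    under the words [sigma X] and [sigma Y]. *)

Section EvaluationMorphism.

Variables (aT rT : finGroupType) (G : {group aT}) (f : {morphism G >-> rT}).
Variables x y : aT.
Hypotheses (Gx : x \in G) (Gy : y \in G).

Lemma mem_lev l : lev x y l \in G.
Proof. by case: l => -[] []; rewrite /lev /= ?groupV. Qed.

Lemma mem_ev u : ev x y u \in G.
Proof. by apply: group_prod => l _; apply: mem_lev. Qed.

Lemma morph_lev l : f (lev x y l) = lev (f x) (f y) l.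
Proof. by case: l => -[] []; rewrite /lev /= ?morphV. Qed.

Lemma morph_ev u : f (ev x y u) = ev (f x) (f y) u.
Proof.
rewrite /ev morph_prod => [|l _]; last exact: mem_lev.
by apply: eq_bigr => l _; apply: morph_lev.
Qed.

End EvaluationMorphism.

Definition morphim_dessin (D : dessin) (rT : finGroupType)
    (f : {morphism dgroup D >-> rT}) : dessin :=
  Dessin (f @* dgroup D) (f (dx D)) (f (dy D)).

Lemma regular_dessin_mem (D : dessin) :
  is_regular_dessin D -> dx D \in dgroup D /\ dy D \in dgroup D.
Proof. by move=> ->; rewrite !mem_gen ?set21 ?set22. Qed.

Lemma morphim_gen_pair (aT rT : finGroupType) (G : {group aT})
    (f : {morphism G >-> rT}) (x y : aT) :
  x \in G -> y \in G -> f @* <<[set x; y]>> = <<[set f x; f y]>>.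
Proof.
move=> Gx Gy; have sxyG : [set x; y] \subset G by rewrite subUset !sub1set Gx.
by rewrite morphim_gen // morphimEsub // imsetU !imset_set1.
Qed.

Lemma morphim_regular_dessin (D : dessin) (rT : finGroupType)
    (f : {morphism dgroup D >-> rT}) :
  is_regular_dessin D -> is_regular_dessin (morphim_dessin f).
Proof.
move=> regD; have [Dx Dy] := regular_dessin_mem regD.
have /(congr1 val)/= defD := regD.
by apply: val_inj; rewrite /= -morphim_gen_pair // -defD.
Qed.

Lemma dessin_isomorphic_sym (D1 D2 : dessin) :
  is_regular_dessin D1 -> dessin_isomorphic D1 D2 -> dessin_isomorphic D2 D1.
Proof.
move=> regD [f [isof fx fy]]; have [Dx Dy] := regular_dessin_mem regD.
exists [morphism of isom_inv isof]; split; first exact: isom_sym.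
  by rewrite -fx; apply: invmE.
by rewrite -fy; apply: invmE.
Qed.

Lemma Aut_char_mem (gT : finGroupType) (G K : {group gT}) (a : {perm gT}) g :
  K \char G -> a \in Aut G -> (a g \in K) = (g \in K).
Proof.
case/charP=> sKG fixK Aa.
rewrite -{1}(fixK _ (injm_autm Aa) (im_autm Aa)) morphimEsub //.
exact: (mem_imset _ _ (@perm_inj _ a)).
Qed.

Lemma injm_external_symmetry (D : dessin) (f : {morphism dgroup D >-> dtype D})
    (sigma : Delta -> Delta) :
  is_regular_dessin D -> 'injm f ->
  f (dx D) = ev (dx D) (dy D) (sigma DX) ->
  f (dy D) = ev (dx D) (dy D) (sigma DY) ->
  external_symmetry D sigma.
Proof.
move=> regD injf fx fy; have [Dx Dy] := regular_dessin_mem regD.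
have imf : f @* dgroup D = dgroup D.
  apply/morphim_fixP => //.
  have /(congr1 val)/= -> := morphim_regular_dessin f regD.
  by rewrite gen_subG subUset !sub1set fx fy !mem_ev.
by exists (aut injf imf); [apply: Aut_aut | rewrite !autE].
Qed.

Lemma morphim_external_symmetry (D : dessin) (rT : finGroupType)
    (f : {morphism dgroup D >-> rT}) (sigma : Delta -> Delta) :
  is_regular_dessin D -> 'ker f \char dgroup D ->
  external_symmetry D sigma -> external_symmetry (morphim_dessin f) sigma.
Proof.
move=> regD charK [a Aa [ax ay]]; have [Dx Dy] := regular_dessin_mem regD.
have faM : {in dgroup D &, {morph f \o a : g h / g * h}}.
  by move=> g h Dg Dh; rewrite /= -(autmE Aa) !morphM ?Aut_closed.
have kerfa : 'ker (Morphism faM) = 'ker f.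
  apply/setP => g; rewrite !inE; case Dg: (g \in dgroup D) => //=.
  by have := Aut_char_mem g charK Aa; rewrite !inE Aut_closed ?Dg.
have sKK : 'ker f \subset 'ker (Morphism faM) by rewrite kerfa.
pose b := factm_morphism sKK (subxx _).
have bf g : g \in dgroup D -> b (f g) = f (a g) by apply: factmE.
apply: (@injm_external_symmetry (morphim_dessin f) b).
- exact: morphim_regular_dessin.
- exact/injm_factmP.
- by rewrite bf // ax; apply: morph_ev.
- by rewrite bf // ay; apply: morph_ev.
Qed.

Lemma external_symmetry_isomorphic (D1 D2 : dessin) (sigma : Delta -> Delta) :
  is_regular_dessin D1 -> dessin_isomorphic D1 D2 ->
  external_symmetry D1 sigma -> external_symmetry D2 sigma.
Proof.
move=> regD [f [/isomP[injf imf] fx fy]].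
have <- : morphim_dessin f = D2.
  case: D2 f injf imf fx fy => T H x y /= f _ imf <- <-.
  by congr Dessin; apply: val_inj.
apply: morphim_external_symmetry => //.
by rewrite (trivgP injf) char1.
Qed.

Lemma dffun_morphM (aT : finGroupType) (G : {group aT}) (I : finType)
    (rT : I -> finGroupType) (f : forall i, aT -> rT i) :
  (forall i, {in G &, {morph f i : g h / g * h}}) ->
  {in G &, {morph (fun g => [ffun i => f i g] : {dffun forall i, rT i}) :
              g h / g * h}}.
Proof. by move=> fM g h Gg Gh; apply/ffunP => i; rewrite !ffunE fM. Qed.

Section ParallelProduct.

Variables (I : finType) (E : I -> dessin).

Lemma dessin_isomorphic_parallel_product (D : dessin)
    (f : forall i, {morphism dgroup D >-> dtype (E i)}) :
  is_regular_dessin D ->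
  (forall i, f i (dx D) = dx (E i)) -> (forall i, f i (dy D) = dy (E i)) ->
  {in dgroup D, forall g, (forall i, f i g = 1) -> g = 1} ->
  dessin_isomorphic D (parallel_product E).
Proof.
move=> regD fx fy f_sep.
pose F := Morphism (dffun_morphM (fun i => morphM (f i))).
have Fx : F (dx D) = dx (parallel_product E).
  by apply/ffunP => i; rewrite !ffunE.
have Fy : F (dy D) = dy (parallel_product E).
  by apply/ffunP => i; rewrite !ffunE.
exists F; split=> //; apply/isomP; split.
  apply/subsetP => g /morphpreP[Dg /set1P Fg1]; apply/set1P/f_sep => // i.
  by move/ffunP/(_ i): Fg1; rewrite !ffunE.
have /(congr1 val)/= -> := morphim_regular_dessin F regD.
by rewrite -[finfun _]/(F (dx D)) Fx -[finfun _]/(F (dy D)) Fy.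
Qed.

Lemma ev_parallel_product (i : I) (u : Delta) :
  let D := parallel_product E in
  ev (dx D) (dy D) u i = ev (dx (E i)) (dy (E i)) u.
Proof.
move=> D; pose coord := @dffun_morphism I (fun j => dtype (E j)) i.
have := morph_ev coord (in_setT (dx D)) (in_setT (dy D)) u.
by rewrite /= !ffunE.
Qed.

Hypothesis regE : forall i, is_regular_dessin (E i).

Lemma parallel_product_coord_mem z (i : I) :
  z \in dgroup (parallel_product E) -> z i \in dgroup (E i).
Proof.
have [Ex Ey] := all_and2 (fun i => regular_dessin_mem (regE i)).
have sDE : dgroup (parallel_product E) \subset setXn (fun i => dgroup (E i)).
  rewrite gen_subG subUset !sub1set.
  apply/andP; split; apply/setXnP => j; rewrite ffunE.
    exact: Ex.
  exact: Ey.
by move=> Dz; have /setXnP := subsetP sDE z Dz; apply.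
Qed.

Lemma parallel_product_external_symmetry (sigma : Delta -> Delta) :
  (forall i, external_symmetry (E i) sigma) ->
  external_symmetry (parallel_product E) sigma.
Proof.
move=> symE; set D := parallel_product E.
have [a Aa /all_and2[ax ay]] := fin_all_exists2 symE.
pose act i (z : {dffun forall j, dtype (E j)}) := a i (z i).
have actM i : {in dgroup D &, {morph act i : z t / z * t}}.
  move=> z t Dz Dt; rewrite /act mulg_ffun.
  by apply: (morphM (autm_morphism (Aa i))); apply: parallel_product_coord_mem.
apply: (@injm_external_symmetry D (Morphism (dffun_morphM actM))) => //.
- apply/injmP => z t Dz Dt /ffunP eq_act; apply/ffunP => i.
  by apply: (@perm_inj _ (a i)); have := eq_act i; rewrite !ffunE.
- by apply/ffunP => i; rewrite ev_parallel_product ffunE /act ffunE; apply: ax.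
- by apply/ffunP => i; rewrite ev_parallel_product ffunE /act ffunE; apply: ay.
Qed.

End ParallelProduct.

Lemma prodgM_commute_uniq (M : monoidType) (I : eqType) (r : seq I)
    (P : pred I) (F H : I -> M) :
  uniq r ->
  (forall i j, P i -> P j -> i != j -> commute (F i) (H j)) ->
  \prod_(i <- r | P i) (F i * H i) =
    \prod_(i <- r | P i) F i * \prod_(i <- r | P i) H i.
Proof.
move=> + cFH; elim: r => [|i r IHr] /=; first by rewrite !big_nil mulg1.
case/andP=> ir ur; rewrite !big_cons; case: ifP => Pi; last exact: IHr.
rewrite (IHr ur) -!mulgA; congr (_ * _); rewrite !mulgA; congr (_ * _).
rewrite big_seq_cond; apply: commute_prod => j /andP[jr Pj].
by apply/commute_sym/cFH => //; apply: contraNneq ir => <-.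
Qed.

Section InternalDirectProduct.

Variables (gT : finGroupType) (I : finType) (P : pred I).
Variables (H : I -> {group gT}) (G : {group gT}).
Hypothesis dG : \big[dprod/1]_(i | P i) H i = G.

Lemma bigdprod_sub i : P i -> H i \subset G.
Proof. by move=> Pi; rewrite -(bigdprodWY dG) sub_gen // (bigcup_sup i). Qed.

Lemma bigdprod_cent i j : P i -> P j -> i != j -> H i \subset 'C(H j).
Proof.
move: i j; apply/bigcprodYP.
by rewrite (bigdprodWcp dG) /= bigprodGE (bigdprodWY dG).
Qed.

Lemma bigdprod_prodgM (z t : I -> gT) :
  (forall i, P i -> z i \in H i) -> (forall i, P i -> t i \in H i) ->
  \prod_(i | P i) (z i * t i) = \prod_(i | P i) z i * \prod_(i | P i) t i.
Proof.
move=> Hz Ht; apply: prodgM_commute_uniq (index_enum_uniq _) _ => i j Pi Pj nij.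
by apply: (centsP (bigdprod_cent Pi Pj nij)); [apply: Hz | apply: Ht].
Qed.

End InternalDirectProduct.

Section Projections.

Variables (gT : finGroupType) (k : nat) (Gs : 'I_k -> {group gT}).
Variable G : {group gT}.
Hypothesis dG : \big[dprod/1]_i Gs i = G.

Local Notation pr := (dprod_proj Gs).

Lemma mem_dprod_proj i g : g \in G -> pr i g \in Gs i.
Proof.
move=> Gg; have [c [Gc -> _]] := mem_bigdprod dG Gg.
by rewrite (dprod_projP i dG) => [|j]; apply: Gc.
Qed.

Lemma prod_dprod_proj g : g \in G -> \prod_i pr i g = g.
Proof.
move=> Gg; have [c [Gc -> _]] := mem_bigdprod dG Gg.
by apply: eq_bigr => i _; apply: dprod_projP dG _ => j; apply: Gc.
Qed.

Lemma dprod_projM i : {in G &, {morph pr i : g h / g * h}}.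
Proof.
move=> g h Gg Gh; rewrite -{1}(prod_dprod_proj Gg) -{1}(prod_dprod_proj Gh).
rewrite -(bigdprod_prodgM dG) => [|j _|j _]; [|exact: mem_dprod_proj..].
by rewrite (dprod_projP i dG) // => j; rewrite groupM ?mem_dprod_proj.
Qed.

Canonical dprod_proj_morphism i := Morphism (dprod_projM i).

Lemma dprod_proj_id i g : g \in Gs i -> pr i g = g.
Proof.
move=> Gg; pose z j := if j == i then g else 1.
have Gz j : z j \in Gs j by rewrite /z; case: eqP => [->|].
have {1}<- : \prod_j z j = g by rewrite -big_mkcond big_pred1_eq.
by rewrite (dprod_projP i dG) // /z eqxx.
Qed.

Lemma im_dprod_proj i : pr i @* G = Gs i.
Proof.
apply/eqP; rewrite eqEsubset; apply/andP; split; apply/subsetP => g.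
  by case/morphimP => h _ Gh ->; apply: mem_dprod_proj.
have sGsG : Gs i \subset G by apply: (bigdprod_sub dG).
by move=> Gs_g; rewrite -(dprod_proj_id Gs_g) mem_morphim ?(subsetP sGsG).
Qed.

Lemma dprod_proj_morph i (f : {morphism G >-> gT}) g :
  (forall j, {in Gs j, forall h, f h \in Gs j}) -> g \in G ->
  pr i (f g) = f (pr i g).
Proof.
move=> stabf Gg; have sGsG j : Gs j \subset G by apply: (bigdprod_sub dG).
rewrite -{1}(prod_dprod_proj Gg) morph_prod => [|j _]; last first.
  by rewrite (subsetP (sGsG j)) ?mem_dprod_proj.
by rewrite (dprod_projP i dG) // => j; rewrite stabf ?mem_dprod_proj.
Qed.

Lemma ker_dprod_proj_char i :
  (forall j, Gs j \char G) -> 'ker (pr i) \char G.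
Proof.
move=> charGs; rewrite /characteristic subsetIl; apply/forall_inP => a Aa.
have stab_a j : {in Gs j, forall h, autm Aa h \in Gs j}.
  by move=> h Gs_h; rewrite autmE (Aut_char_mem _ (charGs j)).
apply/subsetP => _ /imsetP[g Kg ->]; have Gg := dom_ker Kg.
have pr_a : pr i (a g) = a (pr i g) by apply: dprod_proj_morph stab_a Gg.
by rewrite mem_morphpre ?Aut_closed // inE /= pr_a (mker Kg) -(autmE Aa) morph1.
Qed.

End Projections.

Lemma nilpotent_bigdprod_Sylow (gT : finGroupType) (G : {group gT})
    (I : finType) (p : I -> nat) (Gs : I -> {group gT}) :
  nilpotent G -> injective p ->
  (forall q, (q \in primes #|G|) = (q \in codom p)) ->
  (forall i, (p i).-Sylow(G) (Gs i)) ->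
  \big[dprod/1]_i Gs i = G.
Proof.
move=> nilG p_inj p_primes sylGs.
rewrite -[RHS](nilpotent_Fitting nilG) /Fitting.
have eq_p : perm_eq (primes #|G|) (codom p).
  by rewrite uniq_perm ?primes_uniq //; apply/injectiveP.
rewrite (perm_big _ eq_p) big_map big_enum /=.
by apply: eq_bigr => i _; apply: nilpotent_Hall_pcore.
Qed.

Theorem theorem3p9 (gT : finGroupType) (G : {group gT})
    (nilG : nilpotent G)
    (k : nat) (p : 'I_k -> nat) (p_inj : injective p)
    (p_primes : forall q : nat, (q \in primes #|G|) = (q \in codom p))
    (Gs : 'I_k -> {group gT})
    (sylGs : forall i : 'I_k, (p i).-Sylow(G) (Gs i))
    (x y : gT) :
  let D := Dessin G x y in
  let Ds := fun i : 'I_k =>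
    Dessin (Gs i) (dprod_proj Gs i x) (dprod_proj Gs i y) in
  is_regular_dessin D ->
  [/\ forall i : 'I_k, is_regular_dessin (Ds i),
      dessin_isomorphic D (parallel_product Ds) &
      forall sigma : {multiplicative Delta -> Delta}, bijective sigma ->
        (external_symmetry D sigma <->
         forall i : 'I_k, external_symmetry (Ds i) sigma)].
Proof.
move=> D Ds regD.
have dG := nilpotent_bigdprod_Sylow nilG p_inj p_primes sylGs.
have charGs i : Gs i \char G.
  by rewrite (nilpotent_Hall_pcore nilG (sylGs i)) pcore_char.
pose pi i : {morphism dgroup D >-> dtype (Ds i)} := dprod_proj_morphism dG i.
have im_pi i : morphim_dessin (pi i) = Ds i.
  by congr Dessin; apply: val_inj; apply: im_dprod_proj.
have regDs i : is_regular_dessin (Ds i).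
  by rewrite -im_pi; apply: morphim_regular_dessin.
have isoD : dessin_isomorphic D (parallel_product Ds).
  apply: (dessin_isomorphic_parallel_product (f := pi)) => // g Dg pi_g.
  by rewrite -(prod_dprod_proj dG Dg) big1 // => i _; apply: pi_g.
split=> // sigma _; split=> [symD i | symDs].
  rewrite -im_pi; apply: morphim_external_symmetry => //.
  exact: ker_dprod_proj_char.
apply: (external_symmetry_isomorphic _ (dessin_isomorphic_sym regD isoD)) => //.
exact: parallel_product_external_symmetry.
Qed.
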